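(* Let $\lambda>1$, $\theta>0$, $\lambda_j=\lambda^j$, and let $s\ge\theta$. Assume $(a^0,b^0)\in H^s\times H^s$ and $f=(f_0,f_1,f_2,\dots)\in H^s$ (time-independent). Then there exists a time $T>0$ such that the system $$\frac{d}{dt}a_j=-\left(\lambda_j^{\theta}a_ja_{j+1}-\lambda_{j-1}^{\theta}a_{j-1}^2\right)-\left(\lambda_j^{\theta}b_jb_{j+1}-\lambda_{j-1}^{\theta}b_{j-1}^2\right)+f_j,\qquad \frac{d}{dt}b_j=\lambda_j^{\theta}a_jb_{j+1}-\lambda_j^{\theta}b_ja_{j+1},$$ for $j\ge0$ with $a_{-1}=b_{-1}=0$, with initial data $(a(0),b(0))=(a^0,b^0)$, has a unique solution $(a(t),b(t))$ in $H^s\times H^s$ on $[0,T]$.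
   Context: For $s\in\mathbb R$, $H^s$ is the space of real sequences $u=(u_0,u_1,\dots)$ with $\|u\|_{H^s}^2=\sum_{j\ge0}\lambda_j^{2s}u_j^2<\infty$. A solution in $H^s\times H^s$ on $[0,T]$ is a pair $(a(t),b(t))$, $t\in[0,T]$, with $a_j,b_j\in C^1([0,T])$ satisfying the equations for all $j\ge0$, and with $\|a(t)\|_{H^s}$ and $\|b(t)\|_{H^s}$ finite and bounded on $[0,T]$. Uniqueness is within this class. *)

(* Defs.v *)
From Stdlib Require Import Reals.
From Coquelicot Require Import Coquelicot.
Open Scope R_scope.

(** Sequences are [nat -> R]; a time-dependent sequence is [a : R -> nat -> R],
    of which only the values [a t] with [0 <= t <= T] are ever used. *)

Definition lam_ (lam : R) (j : nat) : R := lam ^ j.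

Definition Hs_term (lam s : R) (u : nat -> R) (j : nat) : R :=
  Rpower (lam_ lam j) (2 * s) * u j ^ 2.

Definition in_Hs (lam s : R) (u : nat -> R) : Prop :=
  ex_series (Hs_term lam s u).

(** Meaningful only under [in_Hs]: [Series] is total. *)
Definition Hs_norm (lam s : R) (u : nat -> R) : R :=
  sqrt (Series (Hs_term lam s u)).

Definition time_interval (T t : R) : Prop := 0 <= t <= T.

(** [D_in] and [continue_in] take limits along the interval only, so the
    derivative is one-sided at the endpoints. *)
Definition C1_on (T : R) (x : R -> R) : Prop :=
  exists x' : R -> R,
    forall t, time_interval T t ->
      D_in x x' (time_interval T) t /\ continue_in x' (time_interval T) t.

(** [lam_{j-1}^theta * u_{j-1}^2], which vanishes at [j = 0] because
    [u_{-1} = 0]. *)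
Definition inflow (lam theta : R) (u : nat -> R) (j : nat) : R :=
  match j with
  | O => 0
  | S i => Rpower (lam_ lam i) theta * u i ^ 2
  end.

Definition rhs_a (lam theta : R) (f a b : nat -> R) (j : nat) : R :=
  - (Rpower (lam_ lam j) theta * a j * a (S j) - inflow lam theta a j)
  - (Rpower (lam_ lam j) theta * b j * b (S j) - inflow lam theta b j)
  + f j.

Definition rhs_b (lam theta : R) (a b : nat -> R) (j : nat) : R :=
  Rpower (lam_ lam j) theta * a j * b (S j)
  - Rpower (lam_ lam j) theta * b j * a (S j).

Definition Hs_bounded_on (lam s T : R) (u : R -> nat -> R) : Prop :=
  (forall t, time_interval T t -> in_Hs lam s (u t)) /\
  exists M : R, forall t, time_interval T t -> Hs_norm lam s (u t) <= M.

Definition is_solution (lam theta s : R) (f : nat -> R) (T : R)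
    (a b : R -> nat -> R) : Prop :=
  (forall j, C1_on T (fun t => a t j) /\ C1_on T (fun t => b t j)) /\
  (forall j t, time_interval T t ->
     D_in (fun r => a r j) (fun r => rhs_a lam theta f (a r) (b r) j)
       (time_interval T) t /\
     D_in (fun r => b r j) (fun r => rhs_b lam theta (a r) (b r) j)
       (time_interval T) t) /\
  Hs_bounded_on lam s T a /\
  Hs_bounded_on lam s T b.

Definition has_initial_data (a0 b0 : nat -> R) (a b : R -> nat -> R) : Prop :=
  forall j, a 0 j = a0 j /\ b 0 j = b0 j.

(* Main.v *)
(** Since [theta <= s], every coefficient [lam_j^theta] is compensated by one
    factor [|u_j| <= |u|_{H^s} lam_j^{-s}], so the right-hand side is locally
    Lipschitz for the weighted sup norm [sup_j lam_j^s |u_j|]. Picard iteration in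
    that norm, on the set of curves dominated componentwise by a fixed sequence
    [lam_j^{-s} g_j] with [g] in l^2, gives the solution, and the domination puts
    it in [H^s]. For uniqueness, integrating the Lipschitz bound [n] times shows
    that the difference of two solutions is [O((L t)^n / n!)] for every [n]. *)

Require Import Defs.
From Stdlib Require Import Reals Lra Lia Psatz.
From Coquelicot Require Import Coquelicot.
Open Scope R_scope.

(** * Calculus with one-sided derivatives on a closed interval *)

Lemma D_in_of_is_derive (g g' : R -> R) (D : R -> Prop) (t : R) :
  is_derive g t (g' t) -> D_in g g' D t.
Proof.
  intros Hg; apply is_derive_Reals, derivable_pt_lim_D_in in Hg.
  apply limit1_imp with (2 := Hg).
  intros x [_ Hx]; split; [exact I | exact Hx].
Qed.

(** Projection onto [[0, T]]: composing with it extends a function from the interval to the whole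
    line by constants, so two-sided notions of continuity become available at the endpoints. *)
Definition clamp (T t : R) : R := Rmax 0 (Rmin t T).

Lemma clamp_id (T t : R) : time_interval T t -> clamp T t = t.
Proof.
  intros [H0 HT]; unfold clamp; rewrite Rmin_left, Rmax_right; lra.
Qed.

Lemma clamp_interval (T t : R) : 0 <= T -> time_interval T (clamp T t).
Proof.
  intros HT; unfold clamp, time_interval, Rmax, Rmin.
  repeat destruct Rle_dec; lra.
Qed.

Lemma clamp_nonexpansive (T x y : R) :
  Rabs (clamp T x - clamp T y) <= Rabs (x - y).
Proof.
  unfold clamp, Rmax, Rmin, Rabs.
  repeat destruct Rle_dec; repeat destruct Rcase_abs; lra.
Qed.

Lemma continuous_clamp (T t : R) : continuous (clamp T) t.
Proof.
  apply filterlim_locally; intros eps; exists eps; intros y Hy.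
  apply Rle_lt_trans with (2 := Hy), clamp_nonexpansive.
Qed.

(** [g] composed with [clamp] is continuous on the closed interval in the two-sided sense, and at
    interior points its ordinary derivative is the relative derivative of [g]; the usual mean value
    theorem then applies. *)
Lemma D_in_MVT (T t : R) (g g' : R -> R) :
  (forall x, time_interval T x -> D_in g g' (time_interval T) x) ->
  time_interval T t ->
  exists c, 0 <= c <= t /\ g t - g 0 = g' c * t.
Proof.
  intros Hg [Ht0 HtT].
  destruct (MVT_gen (fun x => g (clamp T x)) 0 t g') as [c [Hc E]].
  - rewrite Rmin_left, Rmax_right by lra; intros x Hx.
    apply is_derive_Reals; intros eps Heps.
    destruct (Hg x ltac:(split; lra) eps Heps) as [al [Hal H]].
    (* This radius keeps [x + h] inside [[0, T]], where [clamp] is the identity. *)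
    assert (Hd : 0 < Rmin al (Rmin x (T - x)))
      by (apply Rmin_pos; [lra | apply Rmin_pos; lra]).
    exists (mkposreal _ Hd); simpl; intros h Hh0 Hh.
    assert (Hal' := Rmin_l al (Rmin x (T - x))).
    assert (Hm := Rmin_r al (Rmin x (T - x))).
    assert (H1 := Rmin_l x (T - x)); assert (H2 := Rmin_r x (T - x)).
    assert (Hxh : time_interval T (x + h))
      by (destruct (Rabs_def2 h _ Hh); split; lra).
    rewrite (clamp_id T (x + h)), (clamp_id T x) by (try assumption; split; lra).
    replace h with (x + h - x) at 2 by ring.
    apply H; split.
    + split; [exact Hxh | lra].
    + simpl; unfold Rdist; replace (x + h - x) with h by ring; lra.
  - rewrite Rmin_left, Rmax_right by lra; intros x Hx eps Heps.
    assert (Hxi : time_interval T x) by (split; lra).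
    destruct (cont_deriv _ _ _ _ (Hg x Hxi) eps Heps) as [al [Hal H]].
    exists al; split; [exact Hal |].
    intros y [_ Hy]; simpl in *; unfold Rdist in *.
    rewrite (clamp_id T x) by exact Hxi.
    (* The relative limit excludes the point [x] itself, yet [clamp] may send some [y] other than
       [x] to [x]. *)
    destruct (Req_dec (clamp T y) x) as [-> | Hne].
    { rewrite Rminus_diag, Rabs_R0; exact Heps. }
    apply H; split.
    + split; [apply clamp_interval; lra | exact (not_eq_sym Hne)].
    + rewrite <- (clamp_id T x) by exact Hxi.
      apply Rle_lt_trans with (2 := Hy), clamp_nonexpansive.
  - rewrite Rmin_left, Rmax_right in Hc by lra.
    rewrite !clamp_id, Rminus_0_r in E by (split; lra).
    exists c; split; assumption.
Qed.

(** Comparison with the primitive [phi] of [C * x ^ n]: both [phi + d] and [phi - d] vanish at 0 and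
    have nonnegative derivative. Using the mean value theorem avoids any integrability question for
    [d']. *)
Lemma D_in_pow_bound (T t C : R) (n : nat) (d d' : R -> R) :
  (forall x, time_interval T x -> D_in d d' (time_interval T) x) ->
  d 0 = 0 ->
  (forall x, time_interval T x -> Rabs (d' x) <= C * x ^ n) ->
  time_interval T t ->
  Rabs (d t) <= C * t ^ S n / INR (S n).
Proof.
  intros Hd Hd0 Hb Ht.
  assert (Hn : INR (S n) <> 0) by (apply not_0_INR; discriminate).
  set (phi := fun x => C * x ^ S n / INR (S n)).
  assert (Hphi : forall x, time_interval T x ->
            D_in phi (fun y => C * y ^ n) (time_interval T) x).
  { intros x _; apply D_in_of_is_derive; unfold phi.
    auto_derive; [exact I |]; simpl pred; field; exact Hn. }
  assert (Hphi0 : phi 0 = 0) by (unfold phi; simpl; field; exact Hn).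
  apply Rabs_le; change (- phi t <= d t <= phi t); split.
  - destruct (D_in_MVT T t (fun x => phi x + d x) (fun x => C * x ^ n + d' x))
      as [c [Hc E]]; [| exact Ht |].
    + intros x Hx; apply Dadd; auto.
    + assert (H := Hb c ltac:(destruct Ht; split; lra)).
      apply Rabs_le_between in H; rewrite Hphi0, Hd0 in E; nra.
  - destruct (D_in_MVT T t (fun x => phi x - d x) (fun x => C * x ^ n - d' x))
      as [c [Hc E]]; [| exact Ht |].
    + intros x Hx; apply Dminus; auto.
    + assert (H := Hb c ltac:(destruct Ht; split; lra)).
      apply Rabs_le_between in H; rewrite Hphi0, Hd0 in E; nra.
Qed.

(** * Uniqueness for systems that are Lipschitz on weighted boxes *)

Definition box {I : Type} (w z : I -> R) : Prop := forall i, Rabs (z i) <= w i.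

(** Lipschitz constant [L] on [box w] for the norm [sup_i |z i| / p i]. *)
Definition box_lipschitz {I : Type} (p w : I -> R) (L : R)
    (F : (I -> R) -> I -> R) : Prop :=
  forall z z' eps, box w z -> box w z' ->
    (forall i, Rabs (z i - z' i) <= eps * p i) ->
    forall i, Rabs (F z i - F z' i) <= L * eps * p i.

(** The a priori bound [2 * M * p i] starts an iteration that gains a factor [L * t / n] at its
    [n]-th round. No smallness of [T * L] is required. *)
Lemma ode_unique {I : Type} (p : I -> R) (F : (I -> R) -> I -> R)
    (T M L : R) (z z' : R -> I -> R) :
  box_lipschitz p (fun i => M * p i) L F ->
  (forall t, time_interval T t -> box (fun i => M * p i) (z t)) ->
  (forall t, time_interval T t -> box (fun i => M * p i) (z' t)) ->
  (forall i t, time_interval T t ->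
     D_in (fun r => z r i) (fun r => F (z r) i) (time_interval T) t) ->
  (forall i t, time_interval T t ->
     D_in (fun r => z' r i) (fun r => F (z' r) i) (time_interval T) t) ->
  (forall i, z 0 i = z' 0 i) ->
  forall t, time_interval T t -> forall i, z t i = z' t i.
Proof.
  intros HL Hz Hz' Dz Dz' H0.
  assert (B : forall n i t, time_interval T t ->
            Rabs (z t i - z' t i)
            <= 2 * M * p i * L ^ n / INR (Factorial.fact n) * t ^ n).
  { induction n as [|n IH]; intros i t Ht.
    - simpl. assert (H1 := Hz t Ht i); assert (H2 := Hz' t Ht i).
      simpl in H1, H2. apply Rabs_le_between in H1, H2.
      apply Rabs_le; lra.
    (* At time [x] the induction hypothesis reads [eps * p k] with [eps = q * x ^ n], so the
       Lipschitz bound is applied with an [eps] depending on time. *)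
    - set (q := 2 * M * L ^ n / INR (Factorial.fact n)).
      eapply Rle_trans.
      + apply (D_in_pow_bound T t (L * q * p i) n (fun r => z r i - z' r i)
                 (fun r => F (z r) i - F (z' r) i)).
        * intros x Hx; apply Dminus; auto.
        * rewrite H0; ring.
        * intros x Hx.
          eapply Rle_trans.
          -- apply (HL (z x) (z' x) (q * x ^ n)); auto.
             intros k; eapply Rle_trans; [apply IH; exact Hx |].
             right; unfold q; field; apply INR_fact_neq_0.
          -- right; ring.
        * exact Ht.
      + right; unfold q; rewrite fact_simpl, mult_INR; simpl (L ^ S n).
        field; split; [apply INR_fact_neq_0 | apply not_0_INR; discriminate]. }
  intros t Ht i.
  assert (Hlim : is_lim_seq
            (fun n => 2 * M * p i * ((L * t) ^ n / INR (Factorial.fact n)))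
            (2 * M * p i * 0)).
  { apply (is_lim_seq_scal_l _ (2 * M * p i) 0).
    apply is_lim_seq_Reals, cv_speed_pow_fact. }
  assert (H : Rbar_le (Rabs (z t i - z' t i)) (2 * M * p i * 0)).
  { eapply is_lim_seq_le; [| apply is_lim_seq_const | exact Hlim].
    intros n; simpl; eapply Rle_trans; [apply (B n i t Ht) |].
    right; rewrite Rpow_mult_distr; field; apply INR_fact_neq_0. }
  simpl in H; rewrite Rmult_0_r in H.
  assert (H1 := Rabs_pos (z t i - z' t i)).
  apply Rminus_diag_uniq; destruct (Req_dec (z t i - z' t i) 0) as [E | E];
    [exact E | apply Rabs_pos_lt in E; lra].
Qed.

(** * Limits of geometrically convergent sequences *)

Lemma geometric_small (C eps : R) : 0 < eps -> exists n, C * (/ 2) ^ n < eps.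
Proof.
  intros Heps.
  assert (Hlim : is_lim_seq (fun n => C * (/ 2) ^ n) (C * 0)).
  { apply (is_lim_seq_scal_l _ C 0), is_lim_seq_geom.
    rewrite Rabs_pos_eq; lra. }
  apply is_lim_seq_spec in Hlim.
  destruct (Hlim (mkposreal eps Heps)) as [N HN].
  exists N; specialize (HN N (le_n N)); simpl in HN.
  apply Rabs_def2 in HN; lra.
Qed.

Lemma geometric_cauchy (u : nat -> R) (C : R) :
  (forall n, Rabs (u (S n) - u n) <= C * (/ 2) ^ n) ->
  forall n, Rabs (real (Lim_seq u) - u n) <= 2 * C * (/ 2) ^ n.
Proof.
  intros Hu.
  assert (HC : 0 <= C)
    by (specialize (Hu O); simpl in Hu; assert (H := Rabs_pos (u 1%nat - u O)); lra).
  (* Keeping the subtracted tail makes the induction on [m] close exactly: one step costs precisely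
     the decrease of the tail. *)
  assert (Hm : forall m n, Rabs (u (m + n)%nat - u n)
                      <= 2 * C * (/ 2) ^ n - 2 * C * (/ 2) ^ (m + n)).
  { induction m as [|m IH]; intros n; simpl.
    - rewrite Rminus_diag, Rabs_R0; lra.
    - replace (u (S (m + n)) - u n)
        with ((u (S (m + n)) - u (m + n)%nat) + (u (m + n)%nat - u n)) by ring.
      eapply Rle_trans; [apply Rabs_triang |].
      specialize (IH n); specialize (Hu (m + n)%nat); lra. }
  assert (Hpos : forall n, 0 <= 2 * C * (/ 2) ^ n).
  { intros n; apply Rmult_le_pos; [lra | apply pow_le; lra]. }
  assert (Hc : ex_finite_lim_seq u).
  { apply ex_lim_seq_cauchy_corr; intros eps.
    destruct (geometric_small (4 * C) eps (cond_pos eps)) as [N HN].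
    exists N; intros n m Hn Hmm.
    replace n with ((n - N) + N)%nat by lia.
    replace m with ((m - N) + N)%nat by lia.
    assert (H1 := Hm (n - N)%nat N); assert (H2 := Hm (m - N)%nat N).
    assert (P1 := Hpos (n - N + N)%nat); assert (P2 := Hpos (m - N + N)%nat).
    apply Rabs_le_between in H1, H2.
    apply Rabs_def1; lra. }
  apply Lim_seq_correct' in Hc.
  intros n.
  assert (H : Rbar_le (Rabs (real (Lim_seq u) - u n)) (2 * C * (/ 2) ^ n)).
  { apply is_lim_seq_le with (u := fun m => Rabs (u (m + n)%nat - u n))
      (v := fun _ => 2 * C * (/ 2) ^ n).
    - intros m; specialize (Hm m n); specialize (Hpos (m + n)%nat); lra.
    - apply (is_lim_seq_abs _ (Finite (Lim_seq u - u n))).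
      apply is_lim_seq_minus'; [| apply is_lim_seq_const].
      apply is_lim_seq_incr_n, Hc.
    - apply is_lim_seq_const. }
  exact H.
Qed.

(** The geometric bound is uniform in [x], so this is the continuity of a uniform limit. *)
Lemma continuous_geometric_limit (g : R -> R) (u : nat -> R -> R) (C t : R) :
  (forall n x, Rabs (g x - u n x) <= C * (/ 2) ^ n) ->
  (forall n, continuous (u n) t) ->
  continuous g t.
Proof.
  intros Hg Hu; apply filterlim_locally; intros eps.
  destruct (geometric_small (3 * C) eps (cond_pos eps)) as [N HN].
  assert (Hd : 0 < (eps - 2 * (C * (/ 2) ^ N))).
  { assert (H := Hg N t); assert (H' := Rabs_pos (g t - u N t)); lra. }
  assert (Hl := proj1 (filterlim_locally _ _) (Hu N) (mkposreal _ Hd)).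
  revert Hl; apply filter_imp; intros x Hx.
  change (Rabs (u N x - u N t) < eps - 2 * (C * (/ 2) ^ N)) in Hx.
  change (Rabs (g x - g t) < eps).
  assert (H1 := Hg N x); assert (H2 := Hg N t).
  apply Rabs_le_between in H1, H2; apply Rabs_def2 in Hx.
  apply Rabs_def1; lra.
Qed.

(** * Picard iteration inside an invariant box *)

Section Picard.

(** Two profiles with separate roles: [p] is the weight of the sup norm in which the iteration
    contracts, while [w] bounds the box that the iteration preserves. The box carries finer
    information than the norm, and the limit inherits it. *)
Context {I : Type} (F : (I -> R) -> I -> R) (z0 p w : I -> R) (T L B : R).
Hypothesis HT : 0 <= T.
Hypothesis Hp : forall i, 0 <= p i.
Hypothesis HB : 0 <= B.
Hypothesis Hw : forall i, w i <= B * p i.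
Hypothesis F_continuous : forall z : R -> I -> R,
  (forall i t, continuous (fun r => z r i) t) ->
  forall i t, continuous (fun r => F (z r) i) t.
Hypothesis F_box : forall z, box w z ->
  forall i, Rabs (z0 i) + T * Rabs (F z i) <= w i.
Hypothesis F_lipschitz : box_lipschitz p w L F.
Hypothesis HLT : T * L <= / 2.

(** Freezing [z] outside [[0, T]] makes all bounds global in time. *)
Let picard (z : R -> I -> R) (t : R) (i : I) : R :=
  z0 i + RInt (fun r => F (z r) i) 0 (clamp T t).

Let iterate (n : nat) : R -> I -> R := Nat.iter n picard (fun _ => z0).

(** [Lim_seq] is total; [limit_near] shows that these coordinatewise limits are genuine and uniform
    relative to [p]. *)
Let limit (t : R) (i : I) : R := real (Lim_seq (fun n => iterate n t i)).

Let admissible (z : R -> I -> R) : Prop :=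
  (forall i t, continuous (fun r => z r i) t) /\ (forall t, box w (z t)).

Lemma admissible_ex_RInt (z : R -> I -> R) (i : I) (a b : R) :
  admissible z -> ex_RInt (fun r => F (z r) i) a b.
Proof.
  intros [Hz _]; apply (@ex_RInt_continuous R_CompleteNormedModule).
  intros r _; apply F_continuous, Hz.
Qed.

(** Without [clamp] the upper bound of integration is free, and since the integrand is continuous on
    the whole line the derivative is two-sided even at 0 and [T]. *)
Lemma integral_is_derive (z : R -> I -> R) (i : I) (t : R) :
  admissible z ->
  is_derive (fun t => z0 i + RInt (fun r => F (z r) i) 0 t) t (F (z t) i).
Proof.
  intros Hz.
  replace (F (z t) i) with (plus zero (F (z t) i)) by apply plus_zero_l.
  apply (@is_derive_plus R_AbsRing R_NormedModule); [apply @is_derive_const |].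
  apply (is_derive_RInt (fun r => F (z r) i) _ 0).
  - apply filter_forall; intros b; apply (@RInt_correct R_CompleteNormedModule).
    apply admissible_ex_RInt, Hz.
  - apply F_continuous, Hz.
Qed.

Lemma picard_admissible (z : R -> I -> R) : admissible z -> admissible (picard z).
Proof.
  intros Hz; split.
  - intros i t; unfold picard.
    apply (continuous_comp (clamp T)
             (fun s => z0 i + RInt (fun r => F (z r) i) 0 s));
      [apply continuous_clamp |].
    apply (@ex_derive_continuous R_AbsRing R_NormedModule).
    eexists; apply integral_is_derive, Hz.
  - intros t i; unfold picard.
    destruct (clamp_interval T t HT) as [H0 H1].
    assert (Hwz : 0 <= w i - Rabs (z0 i)).
    { assert (H := F_box (z 0) (proj2 Hz 0) i).
      assert (H' := Rabs_pos (F (z 0) i)); nra. }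
    eapply Rle_trans; [apply Rabs_triang |].
    (* The bound on the integrand below divides by [T], so a degenerate interval is treated
       apart. *)
    destruct (Req_dec T 0) as [E | NE].
    { replace (clamp T t) with 0 by lra; rewrite RInt_point.
      change (Rabs (z0 i) + Rabs 0 <= w i); rewrite Rabs_R0; lra. }
    (* [F_box] bounds the integrand by [(w i - Rabs (z0 i)) / T]; over a length at most [T] the
       integral uses up no more than the room left in the box. *)
    assert (Hi : Rabs (RInt (fun r => F (z r) i) 0 (clamp T t))
                 <= (clamp T t - 0) * ((w i - Rabs (z0 i)) / T)).
    { apply abs_RInt_le_const; [exact H0 | apply admissible_ex_RInt, Hz |].
      intros r _; assert (H := F_box (z r) (proj2 Hz r) i).
      apply Rmult_le_reg_l with T; [lra |].
      replace (T * ((w i - Rabs (z0 i)) / T)) with (w i - Rabs (z0 i))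
        by (field; exact NE); lra. }
    assert (Hq : 0 <= (w i - Rabs (z0 i)) / T).
    { apply Rmult_le_pos; [exact Hwz |].
      apply Rlt_le, Rinv_0_lt_compat; lra. }
    assert (Ht : (clamp T t - 0) * ((w i - Rabs (z0 i)) / T)
                 <= w i - Rabs (z0 i)).
    { replace (w i - Rabs (z0 i)) with (T * ((w i - Rabs (z0 i)) / T)) at 2
        by (field; exact NE).
      apply Rmult_le_compat_r; lra. }
    lra.
Qed.

(** Integrating the Lipschitz bound over a length at most [T] gives the factor [T * L], which is at
    most one half. *)
Lemma picard_contracts (z z' : R -> I -> R) (eps : R) :
  admissible z -> admissible z' -> 0 <= eps ->
  (forall t i, Rabs (z t i - z' t i) <= eps * p i) ->
  forall t i, Rabs (picard z t i - picard z' t i) <= / 2 * eps * p i.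
Proof.
  intros Hz Hz' Heps H t i; unfold picard.
  destruct (clamp_interval T t HT) as [H0 H1].
  replace (z0 i + RInt (fun r => F (z r) i) 0 (clamp T t) -
           (z0 i + RInt (fun r => F (z' r) i) 0 (clamp T t)))
    with (minus (RInt (fun r => F (z r) i) 0 (clamp T t))
            (RInt (fun r => F (z' r) i) 0 (clamp T t)))
    by (unfold minus, plus, opp; simpl; ring).
  rewrite <- (@RInt_minus R_CompleteNormedModule)
    by (apply admissible_ex_RInt; assumption).
  assert (HF : forall r, Rabs (F (z r) i - F (z' r) i) <= L * eps * p i).
  { intros r; apply F_lipschitz; [apply Hz | apply Hz' | intros k; apply H]. }
  eapply Rle_trans.
  - apply (abs_RInt_le_const _ _ _ (L * eps * p i)); [exact H0 | | intros r _; apply HF].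
    apply (@ex_RInt_minus R_NormedModule); apply admissible_ex_RInt; assumption.
  - assert (HL := Rle_trans _ _ _ (Rabs_pos _) (HF 0)).
    assert (He : 0 <= eps * p i) by (apply Rmult_le_pos; [lra | apply Hp]).
    nra.
Qed.

Hypothesis z0_box : box w z0.

Lemma iterate_admissible (n : nat) : admissible (iterate n).
Proof.
  induction n as [|n IH].
  - split; [intros i t; apply continuous_const | intros t; exact z0_box].
  - apply picard_admissible, IH.
Qed.

Lemma iterate_step (n : nat) (t : R) (i : I) :
  Rabs (iterate (S n) t i - iterate n t i) <= 2 * B * p i * (/ 2) ^ n.
Proof.
  revert t i; induction n as [|n IH]; intros t i.
  (* The first two iterates both lie in the box, so they differ by at most twice [w i]. *)
  - assert (H1 := proj2 (iterate_admissible 1) t i).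
    assert (H0 := proj2 (iterate_admissible 0) t i).
    specialize (Hw i); apply Rabs_le_between in H0, H1.
    rewrite pow_O; apply Rabs_le; lra.
  - eapply Rle_trans.
    + apply (picard_contracts (iterate (S n)) (iterate n) (2 * B * (/ 2) ^ n));
        try apply iterate_admissible.
      * apply Rmult_le_pos; [lra | apply pow_le; lra].
      * intros r k; eapply Rle_trans; [apply IH | right; ring].
    + right; simpl; ring.
Qed.

Lemma limit_near (n : nat) (t : R) (i : I) :
  Rabs (limit t i - iterate n t i) <= 4 * B * (/ 2) ^ n * p i.
Proof.
  eapply Rle_trans.
  - apply (geometric_cauchy (fun n => iterate n t i) (2 * B * p i)).
    intros m; apply iterate_step.
  - right; ring.
Qed.

Lemma limit_admissible : admissible limit.
Proof.
  split.
  - intros i t.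
    apply continuous_geometric_limit
      with (u := fun n r => iterate n r i) (C := 4 * B * p i).
    + intros n x; eapply Rle_trans; [apply limit_near | right; ring].
    + intros n; apply iterate_admissible.
  (* A limit outside the box would exceed it by a fixed amount, more than the distance to a late
     iterate, which lies inside. *)
  - intros t i; apply Rnot_lt_le; intros H.
    destruct (geometric_small (4 * B * p i) (Rabs (limit t i) - w i)) as [n Hn];
      [lra |].
    assert (H1 := limit_near n t i); assert (H2 := proj2 (iterate_admissible n) t i).
    assert (H3 := Rabs_triang_inv (limit t i) (iterate n t i)).
    lra.
Qed.

Lemma limit_fixed (t : R) (i : I) : limit t i = picard limit t i.
Proof.
  apply Rminus_diag_uniq.
  destruct (Req_dec (limit t i - picard limit t i) 0) as [E | E]; [exact E |].
  apply Rabs_pos_lt in E.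
  destruct (geometric_small (4 * B * p i) _ E) as [n Hn].
  (* Both [limit] and [picard limit] are within [2 * B * (/ 2) ^ n * p i] of iterate [S n], so their
     distance is below itself by the choice of [n]. *)
  assert (H1 := limit_near (S n) t i).
  assert (H2 : Rabs (picard (iterate n) t i - picard limit t i)
               <= / 2 * (4 * B * (/ 2) ^ n) * p i).
  { apply picard_contracts.
    - apply iterate_admissible.
    - apply limit_admissible.
    - apply Rmult_le_pos; [lra | apply pow_le; lra].
    - intros r k; rewrite Rabs_minus_sym; apply limit_near. }
  change (picard (iterate n) t i) with (iterate (S n) t i) in H2.
  simpl ((/ 2) ^ S n) in H1.
  assert (H3 := Rabs_triang (limit t i - iterate (S n) t i)
                  (iterate (S n) t i - picard limit t i)).
  replace (limit t i - iterate (S n) t i + (iterate (S n) t i - picard limit t i))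
    with (limit t i - picard limit t i) in H3 by ring.
  lra.
Qed.

Lemma ode_exists : exists z : R -> I -> R, 
  (forall t, box w (z t)) /\
  (forall i, z 0 i = z0 i) /\
  (forall i t, continuous (fun r => F (z r) i) t) /\
  (forall i t, time_interval T t ->
     D_in (fun r => z r i) (fun r => F (z r) i) (time_interval T) t).
Proof.
  exists limit; split; [| split; [| split]].
  - apply limit_admissible.
  - intros i; rewrite limit_fixed; unfold picard.
    rewrite clamp_id by (split; lra).
    rewrite RInt_point; apply Rplus_0_r.
  - apply F_continuous, limit_admissible.
  - intros i t Ht.
    (* On [[0, T]] the clamp disappears, and [limit] inherits the relative derivative of the
       unclamped integral. *)
    assert (E : forall r, time_interval T r ->
              limit r i = z0 i + RInt (fun s => F (limit s) i) 0 r).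
    { intros r Hr; rewrite limit_fixed; unfold picard.
      rewrite clamp_id by exact Hr; reflexivity. }
    assert (H := D_in_of_is_derive _ (fun r => F (limit r) i) (time_interval T) t
                   (integral_is_derive limit i t limit_admissible)).
    intros eps Heps; destruct (H eps Heps) as [al [Hal Hal']].
    exists al; split; [exact Hal |].
    intros x Hx; rewrite !E by (assumption || apply Hx).
    exact (Hal' x Hx).
Qed.

End Picard.

Lemma continuous_continue_in (g : R -> R) (D : R -> Prop) (t : R) :
  continuous g t -> continue_in g D t.
Proof.
  intros Hg eps Heps.
  destruct (proj1 (filterlim_locally _ _) Hg (mkposreal eps Heps)) as [d Hd].
  exists d; split; [apply cond_pos |].
  intros x [_ Hx]; exact (Hd x Hx).
Qed.

(** * Square-summable sequences and their majorants *)

Lemma sum_n_le_Series (u : nat -> R) (n : nat) :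
  (forall j, 0 <= u j) -> ex_series u -> sum_n u n <= Series u.
Proof.
  intros Hpos Hu.
  apply (is_lim_seq_incr_compare (sum_n u)).
  - exact (Series_correct u Hu).
  - intros k; rewrite sum_Sn; specialize (Hpos (S k)); unfold plus; simpl; lra.
Qed.

Lemma term_le_Series (u : nat -> R) (n : nat) :
  (forall j, 0 <= u j) -> ex_series u -> u n <= Series u.
Proof.
  intros Hpos Hu.
  apply Rle_trans with (2 := sum_n_le_Series u n Hpos Hu).
  destruct n as [|n]; [rewrite sum_O; lra |].
  rewrite sum_Sn; unfold plus; simpl.
  assert (H : 0 <= sum_n u n).
  { rewrite sum_n_Reals; apply cond_pos_sum, Hpos. }
  lra.
Qed.

(** The geometric tail keeps [majorant h] in l^2 while allowing it to drop by at
    most a factor [2] per level, as needed for [rhs_bound]. *)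
Fixpoint majorant (h : nat -> R) (j : nat) : R :=
  match j with
  | O => 2 * h O
  | S i => 2 * h (S i) + / 2 * majorant h i
  end.

Lemma majorant_ge (h : nat -> R) (j : nat) :
  (forall k, 0 <= h k) -> 2 * h j <= majorant h j.
Proof.
  intros Hh.
  assert (Hpos : forall k, 0 <= majorant h k).
  { induction k as [|k IH]; simpl; [specialize (Hh O) | specialize (Hh (S k))]; lra. }
  destruct j as [|j]; simpl; [lra | specialize (Hpos j); lra].
Qed.

Lemma ex_series_majorant_sqr (h : nat -> R) :
  (forall k, 0 <= h k) ->
  ex_series (fun j => h j ^ 2) -> ex_series (fun j => majorant h j ^ 2).
Proof.
  intros Hh Hs.
  (* The extra term [majorant h n ^ 2] is what the next level draws on. The induction reduces to [2
     * (2 * x + y / 2) ^ 2 <= 16 * x ^ 2 + y ^ 2], which is [(4 * x - y) ^ 2 >= 0]. *)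
  assert (H : forall n, sum_n (fun j => majorant h j ^ 2) n + majorant h n ^ 2
                   <= 16 * sum_n (fun j => h j ^ 2) n).
  { induction n as [|n IH].
    - rewrite !sum_O; simpl; nra.
    - rewrite !sum_Sn; unfold plus.
      assert (0 <= (4 * h (S n) - majorant h n) ^ 2) by apply pow2_ge_0.
      simpl in *; nra. }
  apply ex_finite_lim_seq_incr with (u := sum_n (fun j => majorant h j ^ 2))
    (M := 16 * Series (fun j => h j ^ 2)).
  - intros n; rewrite sum_Sn; unfold plus; simpl.
    assert (H0 := pow2_ge_0 (majorant h (S n))); simpl in H0; lra.
  - intros n; specialize (H n); assert (H0 := pow2_ge_0 (majorant h n)).
    assert (H1 := sum_n_le_Series (fun j => h j ^ 2) n
                    (fun j => pow2_ge_0 (h j)) Hs).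
    lra.
Qed.

(** * Weighted estimates for the nonlinearity *)

Definition weight (lam s : R) (j : nat) : R := Rpower (lam_ lam j) (- s).

(** The two unknowns become one family indexed by [bool * nat], with [true] for [a] and [false] for
    [b], so that the abstract results for a single system apply. *)
Definition rhs (lam theta : R) (f : nat -> R) (z : bool * nat -> R)
    (i : bool * nat) : R :=
  let a j := z (true, j) in
  let b j := z (false, j) in
  if fst i then rhs_a lam theta f a b (snd i) else rhs_b lam theta a b (snd i).

Section Weights.

Context (lam theta s : R).
Hypothesis hlam : 1 < lam.
Hypothesis htheta : 0 < theta.
Hypothesis hs : theta <= s.

Let p := weight lam s.
Let c (j : nat) : R := Rpower (lam_ lam j) theta.
Let K := Rpower lam s.

Lemma weight_pos (j : nat) : 0 < weight lam s j.
Proof. apply exp_pos. Qed.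

Lemma lam_ge_1 (j : nat) : 1 <= lam_ lam j.
Proof. apply pow_R1_Rle; lra. Qed.

Lemma ratio_ge_1 : 1 <= Rpower lam s.
Proof.
  rewrite <- (Rpower_O lam) by lra; apply Rle_Rpower; lra.
Qed.

Lemma weight_S (j : nat) : weight lam s j = Rpower lam s * weight lam s (S j).
Proof.
  unfold weight, lam_; assert (Hj := pow_lt lam j ltac:(lra)).
  simpl; rewrite <- Rpower_mult_distr by lra.
  rewrite (Rpower_Ropp lam); field; apply Rgt_not_eq, exp_pos.
Qed.

(** The product is a power of [lam_ lam j >= 1] with exponent [theta - s <= 0]. This is where
    [theta <= s] enters: one factor of decay pays for the coefficient. *)
Lemma weight_coef (j : nat) :
  Rpower (lam_ lam j) theta * weight lam s j <= 1.
Proof.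
  unfold weight; rewrite <- Rpower_plus.
  assert (Hj := lam_ge_1 j).
  rewrite <- (Rpower_O (lam_ lam j)) by lra.
  apply Rle_Rpower; lra.
Qed.

Lemma weight_coef_S (j : nat) :
  Rpower (lam_ lam j) theta * weight lam s (S j) <= 1.
Proof.
  apply Rle_trans with (2 := weight_coef j).
  apply Rmult_le_compat_l; [apply Rlt_le, exp_pos |].
  rewrite (weight_S j); assert (H := ratio_ge_1); assert (H' := weight_pos (S j)).
  nra.
Qed.

Lemma Hs_term_weight (u : nat -> R) (j : nat) :
  Hs_term lam s u j = (u j / weight lam s j) ^ 2.
Proof.
  unfold Hs_term, weight; rewrite Rpower_Ropp.
  replace (2 * s) with (s + s) by ring; rewrite Rpower_plus.
  field; apply Rgt_not_eq, exp_pos.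
Qed.

Lemma product_lipschitz (x x' y y' q r M e : R) :
  0 < q -> 0 < r ->
  Rabs x' <= M * q -> Rabs y <= M * r ->
  Rabs (x - x') <= e * q -> Rabs (y - y') <= e * r ->
  Rabs (x * y - x' * y') <= 2 * M * e * q * r.
Proof.
  intros Hq Hr Hx Hy Hdx Hdy.
  replace (x * y - x' * y') with ((x - x') * y + x' * (y - y')) by ring.
  eapply Rle_trans; [apply Rabs_triang |]; rewrite !Rabs_mult.
  replace (2 * M * e * q * r) with ((e * q) * (M * r) + (M * q) * (e * r)) by ring.
  apply Rplus_le_compat; apply Rmult_le_compat; auto using Rabs_pos.
Qed.

(** The product difference carries [p j * p (S j)]; the second factor absorbs the coefficient [c j]
    and the first remains as the weight. *)
Lemma flux_lipschitz (x x' y y' : nat -> R) (M e : R) (j : nat) :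
  0 <= M -> 0 <= e ->
  (forall k, Rabs (x' k) <= M * p k) -> (forall k, Rabs (y k) <= M * p k) ->
  (forall k, Rabs (x k - x' k) <= e * p k) ->
  (forall k, Rabs (y k - y' k) <= e * p k) ->
  Rabs (c j * x j * y (S j) - c j * x' j * y' (S j)) <= 2 * M * e * p j.
Proof.
  intros HM He Hx Hy Hdx Hdy.
  replace (c j * x j * y (S j) - c j * x' j * y' (S j))
    with (c j * (x j * y (S j) - x' j * y' (S j))) by ring.
  assert (Hc : 0 < c j) by apply exp_pos.
  assert (Hj := weight_pos j); assert (HSj := weight_pos (S j)).
  rewrite Rabs_mult, (Rabs_pos_eq (c j)) by lra.
  assert (H := product_lipschitz (x j) (x' j) (y (S j)) (y' (S j)) _ _ M e
                 Hj HSj (Hx j) (Hy (S j)) (Hdx j) (Hdy (S j))).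
  apply Rle_trans with (c j * (2 * M * e * p j * p (S j))).
  { apply Rmult_le_compat_l; [lra | exact H]. }
  replace (c j * (2 * M * e * p j * p (S j)))
    with ((2 * M * e * p j) * (c j * p (S j))) by ring.
  rewrite <- (Rmult_1_r (2 * M * e * p j)) at 2.
  apply Rmult_le_compat_l; [| exact (weight_coef_S j)].
  unfold p; repeat apply Rmult_le_pos; lra.
Qed.

(** Of the two factors [p j] from the level below, one absorbs [c j] and the other is [K * p (S j)],
    which is the source of [K]. *)
Lemma inflow_lipschitz (x x' : nat -> R) (M e : R) (j : nat) :
  0 <= M -> 0 <= e ->
  (forall k, Rabs (x k) <= M * p k) -> (forall k, Rabs (x' k) <= M * p k) ->
  (forall k, Rabs (x k - x' k) <= e * p k) ->
  Rabs (inflow lam theta x j - inflow lam theta x' j) <= 2 * M * e * (K * p j).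
Proof.
  intros HM He Hx Hx' Hd.
  assert (HK : 1 <= K) by apply ratio_ge_1.
  destruct j as [|j]; simpl.
  { rewrite Rminus_diag, Rabs_R0; assert (Hj := weight_pos 0); unfold p.
    repeat apply Rmult_le_pos; lra. }
  fold (c j).
  replace (c j * (x j * (x j * 1)) - c j * (x' j * (x' j * 1)))
    with (c j * (x j * x j - x' j * x' j)) by ring.
  assert (Hc : 0 < c j) by apply exp_pos.
  assert (Hj := weight_pos j).
  rewrite Rabs_mult, (Rabs_pos_eq (c j)) by lra.
  assert (H := product_lipschitz (x j) (x' j) (x j) (x' j) _ _ M e
                 Hj Hj (Hx' j) (Hx j) (Hd j) (Hd j)).
  apply Rle_trans with (c j * (2 * M * e * p j * p j)).
  { apply Rmult_le_compat_l; [lra | exact H]. }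
  change (K * p (S j)) with (Rpower lam s * weight lam s (S j)).
  rewrite <- weight_S.
  replace (c j * (2 * M * e * p j * p j))
    with ((2 * M * e * p j) * (c j * p j)) by ring.
  fold (p j).
  rewrite <- (Rmult_1_r (2 * M * e * p j)) at 2.
  apply Rmult_le_compat_l; [| exact (weight_coef j)].
  unfold p; repeat apply Rmult_le_pos; lra.
Qed.

Lemma rhs_lipschitz (f : nat -> R) (M : R) :
  0 <= M ->
  box_lipschitz (fun i => p (snd i)) (fun i => M * p (snd i)) (8 * K * M)
    (rhs lam theta f).
Proof.
  intros HM z z' e Hz Hz' Hd [q j].
  assert (Hp0 : 0 < p j) by apply weight_pos.
  (* The sign of [e] is forced, since [e * p j] bounds an absolute value. *)
  assert (He : 0 <= e).
  { assert (H := Rle_trans _ _ _ (Rabs_pos _) (Hd (q, j))); simpl in H; nra. }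
  assert (HK : 1 <= K) by apply ratio_ge_1.
  assert (HMe : 0 <= M * e * p j) by (repeat apply Rmult_le_pos; lra).
  assert (HKMe : M * e * p j <= K * (M * e * p j)) by nra.
  pose (a := fun k => z (true, k)); pose (b := fun k => z (false, k)).
  pose (a' := fun k => z' (true, k)); pose (b' := fun k => z' (false, k)).
  assert (Ha : forall k, Rabs (a k) <= M * p k) by (intros k; apply (Hz (true, k))).
  assert (Hb : forall k, Rabs (b k) <= M * p k) by (intros k; apply (Hz (false, k))).
  assert (Ha' : forall k, Rabs (a' k) <= M * p k) by (intros k; apply (Hz' (true, k))).
  assert (Hb' : forall k, Rabs (b' k) <= M * p k) by (intros k; apply (Hz' (false, k))).
  assert (Hda : forall k, Rabs (a k - a' k) <= e * p k) by (intros k; apply (Hd (true, k))).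
  assert (Hdb : forall k, Rabs (b k - b' k) <= e * p k) by (intros k; apply (Hd (false, k))).
  unfold rhs; simpl snd; simpl fst; destruct q.
  - change (Rabs (rhs_a lam theta f a b j - rhs_a lam theta f a' b' j)
            <= 8 * K * M * e * p j).
    (* The forcing cancels in the difference. Two fluxes at [2 * M] and two inflows at [2 * K * M]
       add up to at most [8 * K * M], as [K >= 1]. *)
    unfold rhs_a; fold (c j).
    assert (H1 := flux_lipschitz a a' a a' M e j HM He Ha' Ha Hda Hda).
    assert (H2 := flux_lipschitz b b' b b' M e j HM He Hb' Hb Hdb Hdb).
    assert (H3 := inflow_lipschitz a a' M e j HM He Ha Ha' Hda).
    assert (H4 := inflow_lipschitz b b' M e j HM He Hb Hb' Hdb).
    apply Rabs_le_between in H1, H2, H3, H4; apply Rabs_le; lra.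
  - change (Rabs (rhs_b lam theta a b j - rhs_b lam theta a' b' j)
            <= 8 * K * M * e * p j).
    unfold rhs_b; fold (c j).
    assert (H1 := flux_lipschitz a a' b b' M e j HM He Ha' Hb Hda Hdb).
    assert (H2 := flux_lipschitz b b' a a' M e j HM He Hb' Ha Hdb Hda).
    apply Rabs_le_between in H1, H2; apply Rabs_le; lra.
Qed.

(** The factors are estimated differently: [x j] by the fine profile [v], and [y (S j)] by the
    coarse bound [B * p], whose decay cancels [c j]. The result stays linear in [v]. *)
Lemma flux_bound (x y v : nat -> R) (B : R) (j : nat) :
  (forall k, Rabs (x k) <= v k) -> (forall k, Rabs (y k) <= B * p k) -> 0 <= B ->
  Rabs (c j * x j * y (S j)) <= B * v j.
Proof.
  intros Hx Hy HB.
  assert (Hc : 0 < c j) by apply exp_pos.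
  rewrite !Rabs_mult, (Rabs_pos_eq (c j)) by lra.
  assert (Hv := Rle_trans _ _ _ (Rabs_pos _) (Hx j)).
  apply Rle_trans with (c j * v j * (B * p (S j))).
  - apply Rmult_le_compat; auto using Rabs_pos.
    + apply Rmult_le_pos; [lra | apply Rabs_pos].
    + apply Rmult_le_compat_l; [lra | apply Hx].
  - assert (H := weight_coef_S j); fold (c j) (p (S j)) in H.
    assert (0 <= B * v j) by (apply Rmult_le_pos; lra).
    nra.
Qed.

Lemma inflow_bound (x v : nat -> R) (B : R) (j : nat) :
  (forall k, Rabs (x k) <= v k) -> (forall k, Rabs (x k) <= B * p k) -> 0 <= B ->
  Rabs (inflow lam theta x j) <= B * match j with O => 0 | S i => v i end.
Proof.
  intros Hx Hx' HB; destruct j as [|j]; simpl.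
  { rewrite Rabs_R0; lra. }
  fold (c j).
  assert (Hc : 0 < c j) by apply exp_pos.
  replace (c j * (x j * (x j * 1))) with (c j * x j * x j) by ring.
  rewrite !Rabs_mult, (Rabs_pos_eq (c j)) by lra.
  assert (Hv := Rle_trans _ _ _ (Rabs_pos _) (Hx j)).
  apply Rle_trans with (c j * v j * (B * p j)).
  - apply Rmult_le_compat; auto using Rabs_pos.
    + apply Rmult_le_pos; [lra | apply Rabs_pos].
    + apply Rmult_le_compat_l; [lra | apply Hx].
  - assert (H := weight_coef j); fold (c j) (p j) in H.
    assert (0 <= B * v j) by (apply Rmult_le_pos; lra).
    nra.
Qed.

(** The growth condition [v j <= 2 * K * v (S j)] lets the inflow into level
    [S j], which is only controlled by [v j], be absorbed at level [S j]. *)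
Lemma rhs_bound (f v : nat -> R) (B : R) (z : bool * nat -> R) (i : bool * nat) :
  0 <= B ->
  (forall j, v j <= B * p j) ->
  (forall j, v j <= 2 * K * v (S j)) ->
  box (fun i => v (snd i)) z ->
  Rabs (rhs lam theta f z i) <= 6 * K * B * v (snd i) + Rabs (f (snd i)).
Proof.
  intros HB Hv HvS Hz; destruct i as [q j].
  pose (a := fun k => z (true, k)); pose (b := fun k => z (false, k)).
  assert (Ha : forall k, Rabs (a k) <= v k) by (intros k; apply (Hz (true, k))).
  assert (Hb : forall k, Rabs (b k) <= v k) by (intros k; apply (Hz (false, k))).
  assert (Ha' : forall k, Rabs (a k) <= B * p k)
    by (intros k; apply Rle_trans with (1 := Ha k), Hv).
  assert (Hb' : forall k, Rabs (b k) <= B * p k)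
    by (intros k; apply Rle_trans with (1 := Hb k), Hv).
  assert (Hvj := Rle_trans _ _ _ (Rabs_pos _) (Ha j)).
  assert (HK : 1 <= K) by apply ratio_ge_1.
  assert (HBv : 0 <= B * v j) by (apply Rmult_le_pos; lra).
  assert (HKBv : B * v j <= K * (B * v j)) by nra.
  assert (Hprev : B * match j with O => 0 | S i => v i end <= B * (2 * K * v j)).
  { apply Rmult_le_compat_l; [exact HB |].
    destruct j as [|j]; [| apply HvS]; repeat apply Rmult_le_pos; lra. }
  assert (Hf := Rabs_pos (f j)).
  unfold rhs; simpl snd; simpl fst; destruct q.
  - change (Rabs (rhs_a lam theta f a b j) <= 6 * K * B * v j + Rabs (f j)).
    (* Two fluxes cost [B * v j] each and two inflows [2 * K * B * v j] each, at most
       [6 * K * B * v j] together. *)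
    unfold rhs_a; fold (c j).
    assert (H1 := flux_bound a a v B j Ha Ha' HB).
    assert (H2 := flux_bound b b v B j Hb Hb' HB).
    assert (H3 := inflow_bound a v B j Ha Ha' HB).
    assert (H4 := inflow_bound b v B j Hb Hb' HB).
    assert (H5 := Rle_refl (Rabs (f j))).
    apply Rabs_le_between in H1, H2, H3, H4, H5; apply Rabs_le; lra.
  - change (Rabs (rhs_b lam theta a b j) <= 6 * K * B * v j + Rabs (f j)).
    unfold rhs_b; fold (c j).
    assert (H1 := flux_bound a b v B j Ha Hb' HB).
    assert (H2 := flux_bound b a v B j Hb Ha' HB).
    apply Rabs_le_between in H1, H2; apply Rabs_le; lra.
Qed.

(** Each component is a polynomial in finitely many coordinates, so coordinatewise continuity is
    enough. *)
Lemma rhs_continuous (f : nat -> R) (z : R -> bool * nat -> R) :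
  (forall i t, continuous (fun r => z r i) t) ->
  forall i t, continuous (fun r => rhs lam theta f (z r) i) t.
Proof.
  intros Hz [q j] t.
  assert (Hmul : forall k x y, continuous x t -> continuous y t ->
            continuous (fun r : R => k * x r * y r) t).
  { intros k x y Hx Hy; apply (continuous_mult (fun r => k * x r) y); [| exact Hy].
    apply (continuous_mult (fun _ => k) x); [apply continuous_const | exact Hx]. }
  assert (Hin : forall q', continuous
            (fun r => inflow lam theta (fun k => z r (q', k)) j) t).
  { intros q'; destruct j as [|j]; simpl; [apply continuous_const |].
    apply continuous_ext with (fun r : R =>
      Rpower (lam_ lam j) theta * z r (q', j) * z r (q', j)).
    - intros r; simpl; ring.
    - apply Hmul; apply Hz. }
  assert (Hsub : forall x y, continuous x t -> continuous y t ->
            continuous (fun r : R => x r - y r) t).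
  { intros x y Hx Hy; apply (continuous_minus x y); assumption. }
  unfold rhs; simpl; destruct q; unfold rhs_a, rhs_b.
  - apply (continuous_plus (fun r : R => - _ - _) (fun _ => f j));
      [| apply continuous_const].
    apply Hsub; [apply (continuous_opp (fun r : R => _ - _)) |];
      apply Hsub; try apply Hin; apply Hmul; apply Hz.
  - apply Hsub; apply Hmul; apply Hz.
Qed.

(** * Passing between the Sobolev norm and pointwise weighted bounds *)

Lemma in_Hs_weighted (u : nat -> R) :
  in_Hs lam s u <-> ex_series (fun j => (u j / weight lam s j) ^ 2).
Proof.
  split; apply ex_series_ext; intros j; [| symmetry]; apply Hs_term_weight.
Qed.

Lemma dominated_Hs (u g : nat -> R) :
  ex_series (fun j => g j ^ 2) ->
  (forall j, Rabs (u j) <= p j * g j) ->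
  in_Hs lam s u /\ Hs_norm lam s u <= sqrt (Series (fun j => g j ^ 2)).
Proof.
  intros Hg Hu.
  assert (H : forall j, 0 <= Hs_term lam s u j <= g j ^ 2).
  { intros j; rewrite Hs_term_weight; split; [apply pow2_ge_0 |].
    assert (Hj : 0 < p j) by apply weight_pos.
    apply pow_maj_Rabs; unfold Rdiv; fold (p j).
    rewrite Rabs_mult, Rabs_inv, (Rabs_pos_eq (p j)) by lra.
    apply Rmult_le_reg_r with (p j); [exact Hj |].
    rewrite Rmult_assoc, Rinv_l by lra; specialize (Hu j); lra. }
  split.
  - apply (@ex_series_le R_AbsRing R_CompleteNormedModule) with (2 := Hg).
    intros j; change (Rabs (Hs_term lam s u j) <= g j ^ 2).
    rewrite Rabs_pos_eq; apply H.
  - apply sqrt_le_1_alt, Series_le; [exact H | exact Hg].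
Qed.

(** A single term of the series is at most its sum. This embeds the solution class into the weighted
    sup norm where uniqueness is proved. *)
Lemma Hs_pointwise (u : nat -> R) (j : nat) :
  in_Hs lam s u -> Rabs (u j) <= Hs_norm lam s u * p j.
Proof.
  intros Hu.
  assert (Hj : 0 < p j) by apply weight_pos.
  assert (H : Rabs (u j / p j) <= Hs_norm lam s u).
  { rewrite <- sqrt_Rsqr_abs; apply sqrt_le_1_alt.
    rewrite Rsqr_pow2; unfold p; rewrite <- Hs_term_weight.
    apply term_le_Series; [| exact Hu].
    intros k; rewrite Hs_term_weight; apply pow2_ge_0. }
  unfold Rdiv in H; rewrite Rabs_mult, Rabs_inv, (Rabs_pos_eq (p j)) in H by lra.
  apply Rmult_le_reg_r with (/ p j); [apply Rinv_0_lt_compat, Hj |].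
  rewrite (Rmult_assoc (Hs_norm lam s u)), Rinv_r by lra; lra.
Qed.

Lemma Hs_bounded_pointwise (T : R) (u : R -> nat -> R) :
  Hs_bounded_on lam s T u ->
  exists M, 0 <= M /\
    forall t, time_interval T t -> forall j, Rabs (u t j) <= M * p j.
Proof.
  intros [Hu [M HM]]; exists (Rmax 0 M); split; [apply Rmax_l |].
  intros t Ht j; eapply Rle_trans; [apply Hs_pointwise, Hu, Ht |].
  apply Rmult_le_compat_r; [apply Rlt_le, weight_pos |].
  apply Rle_trans with (1 := HM t Ht), Rmax_r.
Qed.

End Weights.

(** * Choice of the box and of the time, then local well-posedness *)

Theorem theorem4p1 (lam theta s : R) (a0 b0 f : nat -> R)
  (hlam : 1 < lam) (htheta : 0 < theta) (hs : theta <= s)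
  (ha0 : in_Hs lam s a0) (hb0 : in_Hs lam s b0) (hf : in_Hs lam s f) :
  exists T : R, 0 < T /\
    exists a b : R -> nat -> R,
      is_solution lam theta s f T a b /\
      has_initial_data a0 b0 a b /\
      forall a' b' : R -> nat -> R,
        is_solution lam theta s f T a' b' ->
        has_initial_data a0 b0 a' b' ->
        forall t, 0 <= t <= T ->
          forall j, a' t j = a t j /\ b' t j = b t j.
Proof.
  pose (p := weight lam s); pose (K := Rpower lam s).
  assert (Hp : forall j, 0 < p j) by (intros j; apply weight_pos).
  assert (HK : 1 <= K) by (apply (ratio_ge_1 lam theta); assumption).
  (* Initial data and forcing are gathered into one sequence, rescaled by the weight so that
     membership in [H^s] becomes square-summability. *)
  pose (h := fun j => (Rabs (a0 j) + Rabs (b0 j) + Rabs (f j)) / p j).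
  assert (Hh : forall j, 0 <= h j).
  { intros j; apply Rmult_le_pos; [| apply Rlt_le, Rinv_0_lt_compat, Hp].
    assert (Ha := Rabs_pos (a0 j)); assert (Hb := Rabs_pos (b0 j)).
    assert (Hf := Rabs_pos (f j)); lra. }
  assert (Hh2 : ex_series (fun j => h j ^ 2)).
  { apply in_Hs_weighted in ha0, hb0, hf.
    assert (Hsum := ex_series_plus _ _ (ex_series_plus _ _ ha0 hb0) hf).
    apply (ex_series_scal 3) in Hsum.
    apply (@ex_series_le R_AbsRing R_CompleteNormedModule) with (2 := Hsum).
    intros j; change (Rabs (h j ^ 2) <= 3 * ((a0 j / p j) ^ 2 + (b0 j / p j) ^ 2
                                    + (f j / p j) ^ 2)).
    rewrite Rabs_pos_eq by apply pow2_ge_0.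
    rewrite <- (pow2_abs (a0 j / p j)), <- (pow2_abs (b0 j / p j)),
      <- (pow2_abs (f j / p j)).
    unfold h, Rdiv; rewrite !Rabs_mult, (Rabs_pos_eq (/ p j))
      by apply Rlt_le, Rinv_0_lt_compat, Hp.
    rewrite !Rmult_plus_distr_r.
    generalize (Rabs (a0 j) * / p j), (Rabs (b0 j) * / p j), (Rabs (f j) * / p j).
    intros x y w; assert (H1 := pow2_ge_0 (x - y)); assert (H2 := pow2_ge_0 (y - w)).
    assert (H3 := pow2_ge_0 (x - w)); nra. }
  pose (g := majorant h).
  assert (Hg2 : ex_series (fun j => g j ^ 2)) by (apply ex_series_majorant_sqr; auto).
  assert (Hgh : forall j, 2 * h j <= g j) by (intros j; apply majorant_ge, Hh).
  assert (Hg0 : forall j, 0 <= g j)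
    by (intros j; specialize (Hh j); specialize (Hgh j); lra).
  (* The summand 1 gives [B >= 1] and turns a bound on squares into one on [g], through
     [g j <= 1 + g j ^ 2]. *)
  pose (B := 1 + Series (fun j => g j ^ 2)).
  assert (HgB : forall j, g j <= B).
  { intros j; unfold B.
    assert (H := term_le_Series (fun j => g j ^ 2) j
                   (fun j => pow2_ge_0 (g j)) Hg2); cbv beta in H.
    assert (H' := pow2_ge_0 (g j - 1)); specialize (Hg0 j); nra. }
  assert (HB : 1 <= B).
  { assert (H := term_le_Series (fun j => g j ^ 2) 0
                   (fun j => pow2_ge_0 (g j)) Hg2).
    assert (H' := pow2_ge_0 (g 0%nat)); cbv beta in H; unfold B; lra. }
  pose (v := fun j => p j * g j).
  assert (HvB : forall j, v j <= B * p j)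
    by (intros j; unfold v; specialize (Hp j); specialize (HgB j); nra).
  assert (HvS : forall j, v j <= 2 * K * v (S j)).
  { intros j; unfold v, p; rewrite (weight_S lam s hlam j); fold K p.
    assert (HgS : g j <= 2 * g (S j))
      by (unfold g; simpl; specialize (Hh (S j)); lra).
    assert (0 < K * p (S j)) by (apply Rmult_lt_0_compat; [lra | apply Hp]).
    nra. }
  (* The factor 2 built into [majorant] makes the data fill at most half of the box. *)
  assert (Hdata : forall j, 2 * (Rabs (a0 j) + Rabs (b0 j) + Rabs (f j)) <= v j).
  { intros j; specialize (Hgh j); specialize (Hp j).
    replace (Rabs (a0 j) + Rabs (b0 j) + Rabs (f j)) with (p j * h j)
      by (unfold h; field; lra).
    unfold v; nra. }
  (* With this time [T * (8 * K * B)] is exactly one half, as contraction needs. For invariance, the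
     nonlinear part uses [6 / 16] of [v], and the data with the forcing at most one half. *)
  pose (T := / (16 * (K * B))).
  assert (HKB : 1 <= K * B) by nra.
  assert (HT : 0 < T) by (apply Rinv_0_lt_compat; lra).
  assert (HTKB : T * (K * B) = / 16) by (unfold T; field; lra).
  assert (HT1 : T <= / 16) by nra.
  pose (z0 := fun i : bool * nat => if fst i then a0 (snd i) else b0 (snd i)).
  assert (Hz0 : forall i, 2 * (Rabs (z0 i) + Rabs (f (snd i))) <= v (snd i)).
  { intros [q j]; specialize (Hdata j); unfold z0; simpl.
    assert (Ha := Rabs_pos (a0 j)); assert (Hb := Rabs_pos (b0 j)).
    destruct q; lra. }
  destruct (ode_exists (rhs lam theta f) z0 (fun i => p (snd i))
              (fun i => v (snd i)) T (8 * K * B) B) as [z [Hz [Hz_0 [Hzc Hzd]]]].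
  - lra.
  - intros i; apply Rlt_le, Hp.
  - lra.
  - intros i; apply HvB.
  - apply rhs_continuous.
  - intros z Hz i.
    assert (H := rhs_bound lam theta s hlam htheta hs f v B z i ltac:(lra) HvB HvS Hz).
    fold K in H; specialize (Hz0 i); assert (Hf := Rabs_pos (f (snd i))).
    assert (Hz0i := Rabs_pos (z0 i)).
    assert (E : T * (6 * K * B * v (snd i) + Rabs (f (snd i)))
                = 6 * / 16 * v (snd i) + T * Rabs (f (snd i)))
      by (rewrite <- HTKB; ring).
    nra.
  - intros z z' eps Hz Hz'.
    apply (rhs_lipschitz lam theta s hlam htheta hs f B ltac:(lra)).
    + intros i; apply Rle_trans with (1 := Hz i), HvB.
    + intros i; apply Rle_trans with (1 := Hz' i), HvB.
  - lra.
  - intros i; specialize (Hz0 i); assert (Hf := Rabs_pos (f (snd i))).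
    assert (Hz0i := Rabs_pos (z0 i)); lra.
  - exists T; split; [exact HT |].
    exists (fun t j => z t (true, j)), (fun t j => z t (false, j)).
    split; [| split].
    + split; [| split; [| split]].
      * intros j; split.
        -- exists (fun r => rhs lam theta f (z r) (true, j)); intros t Ht.
           split; [exact (Hzd (true, j) t Ht) |].
           apply continuous_continue_in, Hzc.
        -- exists (fun r => rhs lam theta f (z r) (false, j)); intros t Ht.
           split; [exact (Hzd (false, j) t Ht) |].
           apply continuous_continue_in, Hzc.
      * intros j t Ht; split; [exact (Hzd (true, j) t Ht) | exact (Hzd (false, j) t Ht)].
      (* The dominating sequence [g] does not depend on [t], so the norm bound is uniform in
         time. *)
      * assert (H := fun t => dominated_Hs lam s (fun j => z t (true, j)) g Hg2
                              (fun j => Hz t (true, j))).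
        split; [intros t _; apply H | eexists; intros t _; apply H].
      * assert (H := fun t => dominated_Hs lam s (fun j => z t (false, j)) g Hg2
                              (fun j => Hz t (false, j))).
        split; [intros t _; apply H | eexists; intros t _; apply H].
    + intros j; rewrite !Hz_0; split; reflexivity.
    + intros a' b' [_ [Hd' [Ha' Hb']]] H0'.
      apply Hs_bounded_pointwise in Ha', Hb'.
      destruct Ha' as [Ma [HMa Ha']]; destruct Hb' as [Mb [HMb Hb']].
      (* A box large enough for both solutions. The Lipschitz constant grows with [M], but [T] need
         not shrink, since [ode_unique] puts no condition on [T * L]. *)
      pose (M := B + Ma + Mb).
      pose (z' := fun t (i : bool * nat) =>
                    if fst i then a' t (snd i) else b' t (snd i)).
      assert (E : forall t, time_interval T t -> forall i, z' t i = z t i).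
      { apply (ode_unique (fun i => p (snd i)) (rhs lam theta f) T M (8 * K * M)).
        - apply (rhs_lipschitz lam theta s hlam htheta hs); unfold M; lra.
        - intros t Ht [q j]; specialize (Ha' t Ht j); specialize (Hb' t Ht j).
          fold p in Ha', Hb'; specialize (Hp j); unfold z', M; simpl.
          destruct q; nra.
        - intros t Ht i; specialize (Hz t i); simpl in Hz.
          apply Rle_trans with (1 := Hz), Rle_trans with (1 := HvB _).
          specialize (Hp (snd i)); unfold M; nra.
        - intros [[|] j] t Ht; apply (Hd' j t Ht).
        - exact Hzd.
        - intros [q j]; rewrite Hz_0; destruct (H0' j); destruct q; assumption. }
      intros t Ht j; split; [exact (E t Ht (true, j)) | exact (E t Ht (false, j))].
Qed.
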